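(* Let $p$ be a fixed natural number and let $\mathcal{M}=(E,\mathcal{F})$ be a matroid with $|E|=m$, with $p$-parametric weights $w(e,\lambda)$ and parameter interval $I\subseteq\mathbb{R}^p$. The number of $p$-dimensional surface patches in the graph of the optimal interdiction value function $y\colon I\to\mathbb{R}$ is bounded by $\mathcal{O}(m^{(2p+1)(p+\varepsilon)})$, for any $\varepsilon>0$.
   Context: A matroid $\mathcal{M}=(E,\mathcal{F})$ consists of a finite ground set $E$ and a family $\mathcal{F}\subseteq 2^E$ of independent sets; $k$ denotes its rank. Each $e\in E$ has a $p$-parametric weight $w(e,\lambda)=a_e+\lambda_1 b_{1,e}+\dots+\lambda_p b_{p,e}$ with $a_e,b_{1,e},\dots,b_{p,e}\in\mathbb{Q}$. The parameter interval is $I=I_1\times\dots\times I_p\subseteq\mathbb{R}^p$, where each $I_i\subseteq\mathbb{R}$ is a real interval. The weight of a basis $B$ at $\lambda$ is $w(B,\lambda)=\sum_{e\in B}w(e,\lambda)$. For $e\in E$, $\mathcal{M}_e=(E\setminus\{e\},\{F\in\mathcal{F}:F\subseteq E\setminus\{e\}\})$ is the matroid with $e$ removed, $B^e_\lambda$ is a minimum weight basis of $\mathcal{M}_e$ at $\lambda$, and $y_e\colon I\to\mathbb{R}$, $y_e(\lambda)=w(B^e_\lambda,\lambda)$. The optimal interdiction value function is $y\colon I\to\mathbb{R}$, $y(\lambda)=\max\{y_e(\lambda):e\in E\}$. The graph of each $y_e$ is a union of $p$-dimensional polyhedra (its maximal $p$-dimensional linear pieces). The function $y$ is the upper envelope of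 all these polyhedra over all $e\in E$. The $p$-dimensional surface patches in the graph of $y$ are the $p$-dimensional faces of this upper envelope, i.e. the parts of the graph of $y$ lying over the maximal connected $p$-dimensional relatively open subsets of $I$ on which the envelope is attained by one fixed set of these polyhedra. Constants in the $\mathcal{O}$-notation may depend on $p$ and $\varepsilon$. Standing assumptions. For distinct $e,f\in E$ let $h(e,f)=\{\lambda\in\mathbb{R}^p: w(e,\lambda)=w(f,\lambda)\}$ be the separating hyperplane. (a) No two separating hyperplanes (for different unordered pairs) are identical. (b) No separating hyperplane is vertical, i.e. none contains a line parallel to the $p$-th coordinate axis. (c) For every $e\in E$, the matroid $\mathcal{M}_e$ has a basis of cardinality $k$. *)

(* Defs.v *)
From mathcomp Require Import all_boot all_order all_algebra.
From mathcomp Require Import all_classical all_reals all_analysis.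

Set Implicit Arguments.
Unset Strict Implicit.
Unset Printing Implicit Defensive.

Import Order.TTheory GRing.Theory Num.Theory.
Import numFieldNormedType.Exports.

Local Open Scope ring_scope.
Local Open Scope classical_set_scope.

(* The ground set is a subset of a finite type [T], so that deleting an element
   gives a matroid over the same type. *)
Record matroid (T : finType) := Matroid {
  ground : {set T};
  indep : {set {set T}};
  indep_ground : forall F, F \in indep -> F \subset ground;
  indep0 : finset.set0 \in indep;
  indepS : forall F G : {set T}, F \subset G -> G \in indep -> F \in indep;
  indepX : forall F G : {set T}, F \in indep -> G \in indep ->
    (#|F| < #|G|)%N -> exists2 x, x \in (G :\: F)%SET & (x |: F)%SET \in indep
}.

Section Matroid.
Context {T : finType}.
Implicit Types (M : matroid T) (B : {set T}) (e : T).

Definition is_basis M B : bool := maxset (fun F => F \in indep M) B.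

Definition rank M : nat := \max_(F in indep M) #|F|.

Section Delete.
Variables (M : matroid T) (e : T).

Let dground : {set T} := (ground M :\ e)%SET.
Let dindep : {set {set T}} := [set F in indep M | F \subset dground]%SET.

Fact delete_ground F : F \in dindep -> F \subset dground.
Proof. by rewrite inE => /andP[]. Qed.

Fact delete0 : finset.set0 \in dindep.
Proof. by rewrite inE indep0 finset.sub0set. Qed.

Fact deleteS (F G : {set T}) : F \subset G -> G \in dindep -> F \in dindep.
Proof.
move=> FG; rewrite !inE => /andP[Gi Gs].
by rewrite (indepS FG Gi) (fintype.subset_trans FG Gs).
Qed.

Fact deleteX (F G : {set T}) : F \in dindep -> G \in dindep ->
  (#|F| < #|G|)%N -> exists2 x, x \in (G :\: F)%SET & (x |: F)%SET \in dindep.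
Proof.
rewrite !inE => /andP[Fi Fs] /andP[Gi Gs] FG.
have [x xGF xFi] := indepX Fi Gi FG; exists x => //.
rewrite inE xFi finset.subUset Fs andbT finset.sub1set.
by move: xGF; rewrite inE => /andP[_ /(fintype.subsetP Gs)].
Qed.

Definition delete : matroid T :=
  Matroid delete_ground delete0 deleteS deleteX.

End Delete.
End Matroid.

Section Weights.
Context {R : realType} {p : nat} {T : finType}.
Variables (a : T -> rat) (b : 'I_p -> T -> rat).
Implicit Types (e f : T) (B : {set T}) (l : 'rV[R]_p).

Definition weight e l : R := ratr (a e) + \sum_(i < p) l 0 i * ratr (b i e).

Definition set_weight B l : R := \sum_(e in B) weight e l.

Definition separating e f : set 'rV[R]_p := [set l | weight e l = weight f l].

End Weights.

Section Assumptions.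
Variables (R : realType) (p : nat) (T : finType) (M : matroid T).
Variables (a : T -> rat) (b : 'I_p -> T -> rat).

Definition separating_distinct : Prop :=
  forall e f e' f' : T,
    e \in ground M -> f \in ground M -> e' \in ground M -> f' \in ground M ->
    e != f -> e' != f' -> [set e; f]%SET != [set e'; f']%SET ->
    separating a b e f <> separating a b e' f' :> set 'rV[R]_p.

Definition contains_vertical_line (H : set 'rV[R]_p) : Prop :=
  exists i : 'I_p, i.+1 = p /\
    exists l : 'rV[R]_p, forall t : R, H (l + t *: delta_mx 0 i).

Definition separating_nonvertical : Prop :=
  forall e f : T, e \in ground M -> f \in ground M -> e != f ->
    ~ contains_vertical_line (separating a b e f).

Definition full_rank_deletions : Prop :=
  forall e, e \in ground M ->
    exists B : {set T}, is_basis (delete M e) B /\ #|B| = rank M.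

End Assumptions.

Section Interdiction.
Context {R : realType} {p : nat} {T : finType}.
Variables (M : matroid T) (a : T -> rat) (b : 'I_p -> T -> rat).

(* Every matroid has a basis, so the default value is never used. *)
Definition min_basis (N : matroid T) (l : 'rV[R]_p) : {set T} :=
  odflt finset.set0 [pick B | is_basis N B &&
    [forall B', is_basis N B' ==> (set_weight a b B l <= set_weight a b B' l)]].

Definition interdict_value (e : T) (l : 'rV[R]_p) : R :=
  set_weight a b (min_basis (delete M e) l) l.

(* A supremum over finitely many elements: a maximum if [ground M] is
   nonempty. *)
Definition opt_value (l : 'rV[R]_p) : R :=
  sup [set interdict_value e l | e in [set` ground M]].

End Interdiction.

Section Envelope.
Context {R : realType} {p : nat}.
Implicit Types (I D U : set 'rV[R]_p) (f : 'rV[R]_p -> R).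
Implicit Types (P : set ('rV[R]_p * R)).

Definition box (J : 'I_p -> interval R) : set 'rV[R]_p :=
  [set l | forall i, l 0 i \in J i].

Definition affine (c : R) (u l : 'rV[R]_p) : R := c + \sum_(i < p) u 0 i * l 0 i.

(* Polyhedra are relative to [I], which need not be closed: intersections of
   [I] with finitely many closed half-spaces. *)
Definition polyhedral I D : Prop :=
  exists s : seq (R * 'rV[R]_p),
    D = I `&` [set l | forall h, h \in s -> affine h.1 h.2 l <= 0].

Definition full_dim D : Prop := interior D !=set0.

Definition graph_over f D : set ('rV[R]_p * R) := [set (l, f l) | l in D].

Definition is_maximal {X : Type} (Q : set X -> Prop) (A : set X) : Prop :=
  Q A /\ forall A', Q A' -> A `<=` A' -> A' = A.

Definition linear_polyhedron I f P : Prop :=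
  exists D, [/\ polyhedral I D, full_dim D,
    exists c u, forall l, D l -> f l = affine c u l & P = graph_over f D].

Definition linear_piece I f P : Prop := is_maximal (linear_polyhedron I f) P.

Definition attaining (F : set (set ('rV[R]_p * R))) f (l : 'rV[R]_p) :
    set (set ('rV[R]_p * R)) :=
  [set P | F P /\ P (l, f l)].

Definition relatively_open I U : Prop := exists2 O, open O & U = I `&` O.

(* [f] is meant to be the upper envelope of the family [F]; [S] is the set of
   all the members of [F] that attain it, at every point of [U]. *)
Definition attained_region I (F : set (set ('rV[R]_p * R))) f U : Prop :=
  [/\ relatively_open I U, full_dim U, connected U &
      exists2 S, S !=set0 & forall l, U l -> attaining F f l = S].

Definition envelope_faces I F f : set (set ('rV[R]_p * R)) :=
  [set graph_over f U | U in is_maximal (attained_region I F f)].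

End Envelope.

Section Patches.
Context {R : realType} {p : nat} {T : finType}.
Variables (M : matroid T) (a : T -> rat) (b : 'I_p -> T -> rat).
Variable J : 'I_p -> interval R.

Definition interdict_pieces : set (set ('rV[R]_p * R)) :=
  [set P | exists2 e, e \in ground M &
                      linear_piece (box J) (interdict_value M a b e) P].

Definition surface_patches : set (set ('rV[R]_p * R)) :=
  envelope_faces (box J) interdict_pieces (opt_value M a b).

End Patches.

(* Main.v *)
Require Import Defs.
From mathcomp Require Import all_boot all_order all_algebra.
From mathcomp Require Import all_classical all_reals all_analysis.
From mathcomp Require Import ring.

Import Order.TTheory GRing.Theory Num.Theory.
Import numFieldNormedType.Exports.

Local Open Scope ring_scope.
Local Open Scope classical_set_scope.

(* Call a parameter generic if no two sets of elements tie there unless they tie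
   everywhere. At a generic point of I the order of the weights determines, by
   basis exchange, the minimum weight basis of every deletion, so near it each
   y_e is affine. The points of I with that order of weights, at which moreover
   the y_f that were strictly below the maximal y_e still are, form a convex
   relatively open set attained by one fixed set of pieces; by maximality it
   lies inside every patch that it meets. A patch is therefore determined by the
   order of the weights at one of its generic points together with a maximizing
   e. The order is the sign pattern of at most m^2 affine functions of p
   variables, and p+1 such functions never realize all their sign patterns, so
   the Sauer-Shelah lemma leaves at most (m^2+1)^p orders, hence at most
   m(m^2+1)^p = O(m^(2p+1)) patches. This is enough for p > 0; for p = 0 there
   is at most one patch. *)

(** * Shattered sets and the Sauer-Shelah bound *)

Section Shattering.
Set Implicit Arguments.
Unset Strict Implicit.
Context {X : finType}.
Implicit Types (A : {set {set X}}) (S B : {set X}).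

Definition shatters A S : bool :=
  [forall (S' : {set X} | S' \subset S), [exists B in A, (B :&: S)%SET == S']].

Lemma shattersP A S :
  reflect (forall S', S' \subset S -> exists2 B, B \in A & (B :&: S)%SET = S')
          (shatters A S).
Proof.
apply: (iffP forall_inP) => H S' /H.
  by move=> /exists_inP[B BA /eqP <-]; exists B.
by move=> [B BA <-]; apply/exists_inP; exists B.
Qed.

(* Pajor's form of the Sauer-Shelah lemma: split [A] along an element lying in
   some but not all of its members; a set shattered by both halves stays
   shattered by [A] after adding that element. *)
Lemma leq_card_shatters A : (#|A| <= #|[set S | shatters A S]%SET|)%N.
Proof.
have [n] := ubnP #|A|; elim: n A => // n IH A /ltnSE leAn.
have [A2|] := boolP [exists x : X,
    [exists B in A, x \in B] && [exists B in A, x \notin B]]; last first.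
  (* Without a splitting element [A] has at most one member, and a nonempty [A] shatters the empty
     set. *)
  move=> H; have [->|[B BA]] := set_0Vmem A; first by rewrite cards0.
  rewrite (@leq_trans 1)//; last first.
    apply/card_gt0P; exists finset.set0; rewrite inE; apply/shattersP => S'.
    by rewrite finset.subset0 => /eqP ->; exists B => //; rewrite finset.setI0.
  apply/card_le1P => C CA D.
  rewrite !inE; apply/idP/eqP => [DA|->//].
  apply/setP => x; apply/idP/idP => xx; apply: contraNT H => nx;
    apply/existsP; exists x; apply/andP; split; apply/exists_inP.
  - by exists D. - by exists C. - by exists C. - by exists D.
have /existsP[x /andP[/exists_inP[B1 B1A xB1] /exists_inP[B0 B0A xB0]]] := A2.
pose A1 := [set B in A | x \in B]%SET; pose A0 := [set B in A | x \notin B]%SET.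
have cA : #|A| = (#|A1| + #|A0|)%N.
  rewrite -(cardsID [set B : {set X} | x \in B]%SET A); congr (_ + _)%N;
    by apply: eq_card => B; rewrite !inE // andbC.
have A1gt : (0 < #|A1|)%N by apply/card_gt0P; exists B1; rewrite inE B1A.
have A0gt : (0 < #|A0|)%N by apply/card_gt0P; exists B0; rewrite inE B0A.
have /IH h1 : (#|A1| < n)%N by rewrite (leq_trans _ leAn)// cA -addn1 leq_add2l.
have /IH h0 : (#|A0| < n)%N by rewrite (leq_trans _ leAn)// cA -add1n leq_add2r.
rewrite cA (leq_trans (leq_add h1 h0))//.
set S1 := [set S | shatters A1 S]%SET; set S0 := [set S | shatters A0 S]%SET.
(* All members of [A1] agree at [x], so a set shattered by [A1] cannot contain [x]; likewise for
   [A0]. *)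
have xS1 S : S \in S1 -> x \notin S.
  rewrite inE => /shattersP/(_ finset.set0 (finset.sub0set _))[B].
  rewrite inE => /andP[_ xB] /setP/(_ x).
  by rewrite !inE xB /= => ->.
have xS0 S : S \in S0 -> x \notin S.
  rewrite inE => /shattersP/(_ S (fintype.subxx _))[B].
  rewrite inE => /andP[_ xB] /setP/(_ x).
  by rewrite !inE (negPf xB) /= => <-.
rewrite -cardsUI.
have inj : {in (S1 :&: S0)%SET &, injective (fun S => (x |: S)%SET)}.
  move=> S S' /setIP[/xS1 xS _] /setIP[/xS1 xS' _] /setP e.
  apply/setP => y; have := e y; rewrite !inE; case: eqVneq => [->|//].
  by rewrite (negPf xS) (negPf xS').
rewrite -(card_in_imset inj) -cardsUI.
have -> : ((S1 :|: S0) :&: [set (x |: S)%SET | S in S1 :&: S0] =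
          finset.set0)%SET.
  apply/setP => S; rewrite !inE; apply/negP => /andP[H /imsetP[S' _ eS]].
  have : x \in S by rewrite eS !inE eqxx.
  apply/negP; case/orP: H => H; [apply: xS1|apply: xS0]; by rewrite inE.
rewrite cards0 addn0; apply: subset_leq_card; apply/fintype.subsetP => S.
have subA1 B : B \in A1 -> B \in A by rewrite inE => /andP[].
have subA0 B : B \in A0 -> B \in A by rewrite inE => /andP[].
move=> /finset.setUP[/finset.setUP[]|/imsetP[S' /finset.setIP[h1' h0'] ->]];
  rewrite !inE.
- by move=> /shattersP H; apply/shattersP => S' /H[B /subA1 BA e]; exists B.
- by move=> /shattersP H; apply/shattersP => S' /H[B /subA0 BA e]; exists B.
have := xS1 _ h1'; move: h1' h0'.
rewrite !inE => /shattersP h1' /shattersP h0' xS'.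
apply/shattersP => S'' sS.
have [xS''|xS''] := boolP (x \in S'').
  have [|B BA e] := h1' (S'' :\ x)%SET; first by rewrite finset.subDset.
  exists B; first exact: subA1.
  move: BA; rewrite inE => /andP[_ xB].
  apply/setP => y; move/setP/(_ y): e; rewrite !inE.
  by case: eqVneq => [->|]//=; rewrite xB xS''.
have [|B BA e] := h0' S''.
  apply/fintype.subsetP => y yS; have /fintype.subsetP/(_ y yS) := sS.
  by rewrite !inE; case: eqVneq => [yx|//]; rewrite -yx yS in xS''.
exists B; first exact: subA0.
move: BA; rewrite inE => /andP[_ xB].
apply/setP => y; move/setP/(_ y): e; rewrite !inE.
by case: eqVneq => [->|]//=; rewrite (negPf xB) (negPf xS'').
Qed.

(** A set with at most [k] elements is recovered from the first [k] slots of its enumeration, which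
    read [None] past the end; each slot has [#|X|.+1] possible values. *)
Lemma card_small_sets (k : nat) :
  (#|[set S : {set X} | (#|S| <= k)%N]%SET| <= #|X|.+1 ^ k)%N.
Proof.
pose f (S : {set X}) := [ffun i : 'I_k => onth (enum S) i].
have fK S x : (#|S| <= k)%N -> (x \in S) = [exists i, f S i == Some x].
  move=> Sk; rewrite -mem_enum; apply/idP/existsP => [xS|[i]].
    have lt : (index x (enum S) < k)%N.
      by rewrite (leq_trans _ Sk)// cardE index_mem.
    exists (Ordinal lt); rewrite ffunE /=.
    by rewrite (onthE) (nth_map x) ?index_mem// nth_index.
  rewrite ffunE => /eqP e; rewrite -(onth_nth x _ _ _ e) mem_nth//.
  by rewrite -onthTE e.
rewrite -card_option -[k in (_ ^ k)%N]card_ord -card_ffun.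
rewrite -(@card_in_imset _ _ f) ?max_card// => S S'.
rewrite !inE => Sk S'k e; apply/setP => x.
by rewrite !fK// e.
Qed.

End Shattering.

(** * Affine functions: sign patterns, generic points, convexity *)

Section AffineFunctions.
Set Implicit Arguments.
Unset Strict Implicit.
Context {R : realType} {p : nat}.
Implicit Types (l v : 'rV[R]_p) (F G : 'rV[R]_p -> R) (O A : set 'rV[R]_p).

(** A shattered set has at most [p] elements, so all shattered sets are among the small sets counted
    above. *)
Lemma card_positivity_sets (X : finType) (c : X -> R) (u : X -> 'rV[R]_p)
    (A : {set {set X}}) :
  (forall B, B \in A ->
     exists l, forall x, (x \in B) = (0 < affine (c x) (u x) l)) ->
  (#|A| <= #|X|.+1 ^ p)%N.
Proof.
move=> HA; apply: leq_trans (leq_card_shatters A) _.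
apply: leq_trans (card_small_sets p); apply: subset_leq_card.
apply/fintype.subsetP => S; rewrite !inE => /shattersP shS; rewrite leqNgt.
apply/negP => ltpS.
(* More than [p] linear parts are dependent; a dependency with coefficients [v]
   makes [\sum_j v_j g_j] constant, while the sign patterns of [v] and [-v]
   would make it positive and nonpositive. *)
pose M := (\matrix_(i < #|S|, j < p) u (enum_val i) 0 j)%R.
have /rowV0Pn[v /sub_kermxP vM v0] : kermx M != 0.
  rewrite kermx_eq0 /row_free; apply: contraTN ltpS => /eqP <-.
  by rewrite -leqNgt rank_leq_col.
have [i v_pos] : exists i, v 0 i != 0.
  apply/existsP; apply: contraNT v0; rewrite negb_exists => /forallP H.
  apply/eqP/rowP => i; rewrite mxE; apply/eqP.
  by move: (H i); rewrite negbK.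
wlog {v_pos} v_pos : v {v0} vM / 0 < v 0 i.
  move=> W; move: v_pos; rewrite neq_lt => /orP[v_lt|]; last exact: W.
  by apply: (W (- v)); rewrite ?mulNmx ?vM ?oppr0// mxE oppr_gt0.
have cst l : \sum_j v 0 j * affine (c (enum_val j)) (u (enum_val j)) l =
             \sum_j v 0 j * c (enum_val j).
  under eq_bigr do rewrite /affine mulrDr mulr_sumr.
  rewrite big_split /= exchange_big /= [X in _ + X]big1 ?addr0// => j _.
  transitivity ((v *m M) 0 j * l 0 j); last by rewrite vM mxE mul0r.
  by rewrite mxE mulr_suml; apply: eq_bigr => k _; rewrite !mxE mulrA.
(* Shattering realizes every choice [Q] of which functions are positive. *)
have sgn (Q : pred 'I_#|S|) : exists l, forall j,
    Q j = (0 < affine (c (enum_val j)) (u (enum_val j)) l).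
  have [|B /HA[l Hl] e] := shS [set enum_val j | j in Q]%SET.
    by apply/fintype.subsetP => _ /imsetP[j _ ->]; exact: enum_valP.
  exists l => j; rewrite -Hl.
  have := enum_valP j; move/setP/(_ (enum_val j)): e; rewrite inE => + jS.
  by rewrite jS andbT => ->; rewrite finset.mem_imset; last exact: enum_val_inj.
have [l1 Hl1] := sgn (fun j => 0 < v 0 j).
have [l2 Hl2] := sgn (fun j => v 0 j < 0).
(* At [l2] no term of the sum is positive; at [l1] none is negative and the [i]-th is positive. *)
have : \sum_j v 0 j * c (enum_val j) <= 0.
  rewrite -(cst l2); apply: sumr_le0 => j _.
  have := Hl2 j; case: (ltP 0 (affine _ _ _)) => [/ltW h /ltW h'|h /negbT].
    exact: mulr_le0_ge0.
  by rewrite -leNgt => h'; exact: mulr_ge0_le0.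
apply/negP; rewrite -ltNge -(cst l1) (bigD1 i)//= ltr_pwDl//.
  by rewrite mulr_gt0// -Hl1.
apply: sumr_ge0 => j _.
have := Hl1 j; case: (ltP 0 (affine _ _ _)) => [/ltW h /ltW h'|h /negbT].
  exact: mulr_ge0.
by rewrite -leNgt => h'; exact: mulr_le0.
Qed.

Definition is_affine F : Prop := exists c u, forall l, F l = affine c u l.

Lemma is_affineB F G : is_affine F -> is_affine G ->
  is_affine (fun l => F l - G l).
Proof.
move=> [c [u Fcu]] [d [v Gdv]]; exists (c - d), (u - v) => l.
rewrite Fcu Gdv /affine opprD addrACA -sumrB; congr (_ + _).
by apply: eq_bigr => i _; rewrite !mxE mulrBl.
Qed.

Lemma is_affine_line F l l' (t : R) : is_affine F ->
  F (l + t *: (l' - l)) = (1 - t) * F l + t * F l'.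
Proof.
move=> [c [u Fcu]]; rewrite !Fcu /affine !mulrDr addrACA -mulrDl subrK mul1r.
congr (_ + _); rewrite !mulr_sumr -big_split; apply: eq_bigr => i _ /=.
by rewrite !mxE; ring.
Qed.

Lemma is_affine_continuous F : is_affine F -> continuous F.
Proof.
move=> [c [u Fcu]]; rewrite (_ : F = affine c u); last exact/funext.
pose f i (l : 'rV[R]_p) := u 0 i * l 0 i.
have fc i : continuous (f i).
  move=> l.
  exact: (cvgM (@cst_continuous _ _ (u 0 i) l) (@coord_continuous _ _ _ _ _ _)).
have sumc : continuous (fun l => \sum_i f i l).
  by apply: (continuous_big (@add_continuous R)) => i _; exact: fc.
by move=> l; exact: (cvgD (@cst_continuous _ _ c l) (sumc l)).
Qed.

Lemma open_affine_lt F G : is_affine F -> is_affine G ->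
  open [set l | F l < G l].
Proof.
move=> Fa Ga; have /is_affine_continuous/continuousP/(_ _ (@open_gt _ 0)) :=
  is_affineB Ga Fa.
by rewrite (_ : _ @^-1` _ = [set l | F l < G l])//; apply/funext => l /=;
  rewrite subr_gt0.
Qed.

Lemma line_continuous l v : continuous (fun t : R => l + t *: v).
Proof.
by move=> t; apply: cvgD; [exact: cst_continuous|exact: scalel_continuous].
Qed.

(** On the line from [l0] to [l], [F] takes the value [t * F l]; nonnegativity for small [t] of both
    signs forces [F l = 0]. *)
Lemma is_affine_ge0_eq0 F O l0 : is_affine F -> open O -> O l0 ->
  (forall l, O l -> 0 <= F l) -> F l0 = 0 -> forall l, F l = 0.
Proof.
move=> Fa oO Ol0 F0 Fl0 l.
have : \forall t \near (0 : R), O (l0 + t *: (l - l0)).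
  have /continuousP/(_ _ oO) := @line_continuous l0 (l - l0).
  by move=> oV; apply: open_nbhs_nbhs; split => //=; rewrite scale0r addr0.
move=> /nbhs_ballP[e /= e0 He].
have H t : `|t| < e -> 0 <= t * F l.
  move=> te; have := F0 _ (He t _); rewrite is_affine_line// Fl0 mulr0 add0r.
  by apply; rewrite /ball /= sub0r normrN.
have h : `|e / 2| < e.
  by rewrite gtr0_norm ?divr_gt0// gtr_pMr// invf_lt1 ?ltr1n.
have := H _ h; have := H (- (e / 2)); rewrite normrN => /(_ h).
rewrite mulNr oppr_ge0 => h1 h2.
have /eqP : e / 2 * F l = 0 by apply/eqP; rewrite eq_le h1.
by rewrite mulf_eq0 (gt_eqF (divr_gt0 e0 _))//= => /eqP.
Qed.

(** An affine function that is not identically zero cannot vanish on a nonempty open set, so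
    finitely many zero sets can be removed one after the other. The induction keeps a whole open set
    [V] to leave room for the next removal. *)
Lemma generic_point (K : finType) (F : K -> 'rV[R]_p -> R) O :
  (forall k, is_affine (F k)) -> open O -> O !=set0 ->
  exists2 l, O l & forall k, F k l = 0 -> forall l', F k l' = 0.
Proof.
move=> Fa oO O0.
suff H : forall s : seq K, exists V, [/\ open V, V !=set0, V `<=` O &
    forall k l, k \in s -> V l -> F k l = 0 -> forall l', F k l' = 0].
  have [V [_ [l Vl] VO H']] := H (enum K).
  by exists l => [|k]; [exact: VO|apply: H' => //; rewrite mem_enum].
elim=> [|k s [V [oV [l Vl] VO IH]]]; first by exists O; split.
have [Fk|] := pselect (forall l', F k l' = 0).
  exists V; split=> //; first by exists l.
  by move=> j l'; rewrite inE => /predU1P[-> _ _|js]; [exact: Fk|exact: IH].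
move=> /existsNP[l' Fl'].
exists (V `&` [set l | F k l != 0]); split.
- apply: openI => //; have := is_affine_continuous (Fa k).
  by move=> /continuousP/(_ _ (@open_neq _ 0)).
- apply: contrapT => H; apply: Fl'.
  have H0 j : V j -> F k j = 0.
    by move=> Vj; apply/eqP; apply: contrapT => /negP n; apply: H; exists j.
  by apply: (is_affine_ge0_eq0 (Fa k) oV Vl); [move=> j /H0 ->|exact: H0].
- by move=> j [/VO].
- move=> j l0; rewrite inE => /predU1P[-> [_ /eqP]//|js [+ _]]; exact: IH.
Qed.

Lemma open_forall (X : topologicalType) (K : finType) (P : K -> set X) :
  (forall k, open (P k)) -> open [set x | forall k, P k x].
Proof.
move=> oP; rewrite openE => x Px; apply: filter_forall => k.
by apply: open_nbhs_nbhs; split.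
Qed.

Lemma open_affine_lt_family (K : finType) (c : pred K)
    (F G : K -> 'rV[R]_p -> R) :
  (forall k, is_affine (F k)) -> (forall k, is_affine (G k)) ->
  open [set l | forall k, c k -> F k l < G k l].
Proof.
move=> Fa Ga; suff H k : open [set l | c k -> F k l < G k l].
  exact: (open_forall H).
case: (c k).
  have := open_affine_lt (Fa k) (Ga k).
  by congr open; apply/seteqP; split => l /= => [|/(_ isT)].
by rewrite (_ : [set _ | _] = setT); [exact: openT|apply/seteqP; split].
Qed.

Lemma affine_lt_convex (F G : 'rV[R]_p -> R) l l' (t : R) :
    is_affine F -> is_affine G -> 0 <= t <= 1 -> F l < G l -> F l' < G l' ->
  F (l + t *: (l' - l)) < G (l + t *: (l' - l)).
Proof.
move=> Fa Ga /andP[t0 t1] lt lt'; rewrite !is_affine_line//.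
move: t0; rewrite le_eqVlt => /predU1P[<-|t0].
  by rewrite subr0 !mul1r !mul0r !addr0.
by rewrite ler_ltD ?ltr_pM2l// ler_wpM2l ?subr_ge0// ltW.
Qed.

(** A nonempty convex set is a union of segments sharing the endpoint [l0]. *)
Lemma convex_connected A :
  (forall l l' (t : R), A l -> A l' -> 0 <= t <= 1 -> A (l + t *: (l' - l))) ->
  connected A.
Proof.
move=> cA; have [[l0 Al0]|/set0P/negP/negPn/eqP ->] :=
  pselect (A !=set0); last first.
  exact: connected0.
pose seg l := (fun t : R => l0 + t *: (l - l0)) @` `[0, 1].
have -> : A = \bigcup_(l in A) seg l.
  apply/seteqP; split => [l Al|_ [l Al [t /= t01 <-]]].
    exists l => //; exists 1; first by rewrite /= in_itv /= ler01 lexx.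
    by rewrite scale1r addrC subrK.
  by apply: cA => //; move: t01; rewrite in_itv.
apply: bigcup_connected.
  by exists l0 => l _; exists 0;
    [rewrite /= in_itv /= ler01 lexx|rewrite scale0r addr0].
move=> l _; apply: connected_continuous_connected.
  exact: segment_connected.
exact/continuous_subspaceT/line_continuous.
Qed.

End AffineFunctions.

(** * Minimum weight bases and their dependence on the order of the weights *)

Section MinimumBases.
Set Implicit Arguments.
Unset Strict Implicit.
Context {T : finType}.
Implicit Types (N : matroid T) (B F : {set T}).

Lemma is_basis_indep N B : is_basis N B -> B \in indep N.
Proof. exact: maxsetp. Qed.

Lemma is_basis_ground N B : is_basis N B -> B \subset ground N.
Proof. by move/is_basis_indep/indep_ground. Qed.

Lemma indep_leq_basis N F B : F \in indep N -> is_basis N B ->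
  (#|F| <= #|B|)%N.
Proof.
move=> Fi bB; rewrite leqNgt; apply/negP => lt.
have [x] := indepX (is_basis_indep bB) Fi lt; rewrite inE => /andP[xB _] xBi.
have := maxsetsup bB xBi (finset.subsetUr _ _).
by move/setP/(_ x); rewrite !inE eqxx (negPf xB).
Qed.

(** A maximal independent set between [F] and [F :|: B] is at least as large as [B], otherwise
    exchange would add an element of [B]. As no independent set outgrows [B], it is a basis. *)
Lemma basis_extension N F B : F \in indep N -> is_basis N B ->
  exists2 B', is_basis N B' & F \subset B' /\ B' \subset (F :|: B)%SET.
Proof.
move=> Fi bB; pose P G := (G \in indep N) && (G \subset F :|: B)%SET.
have PF : P F by rewrite /P Fi finset.subsetUl.
have [B' mB' FB'] := maxset_exists PF.
have /andP[B'i B's] := maxsetp mB'.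
exists B' => //; have leBB' : (#|B| <= #|B'|)%N.
  rewrite leqNgt; apply/negP => lt.
  have [x] := indepX B'i (is_basis_indep bB) lt.
  rewrite inE => /andP[xB' xB] xBi.
  have : P (x |: B')%SET.
    by rewrite /P xBi /= finset.subUset B's andbT finset.sub1set inE xB orbT.
  move=> /(maxsetsup mB')/(_ (finset.subsetUr _ _)) /setP/(_ x).
  by rewrite !inE eqxx (negPf xB').
apply/maxsetP; split=> // G Gi B'G; apply/eqP.
by rewrite eq_sym eqEcard B'G (leq_trans (indep_leq_basis Gi bB)).
Qed.

Definition optimal_basis {R : numDomainType} N (w : T -> R) B : Prop :=
  is_basis N B /\
  forall B', is_basis N B' -> \sum_(x in B) w x <= \sum_(x in B') w x.

(** Extending [x |: (B :&: B')] inside [x |: B'] gives a basis that trades one [z] of [B'] for [x];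
    optimality of [B'] then forbids [w x < w z]. *)
Lemma optimal_basis_exchange {R : numDomainType} N (w : T -> R) B B' x :
    is_basis N B -> optimal_basis N w B' -> x \in B -> x \notin B' ->
  exists2 z, z \in (B' :\: B)%SET & ~~ (w x < w z).
Proof.
move=> bB [bB' oB'] xB xB'.
have Ai : (x |: (B :&: B'))%SET \in indep N.
  apply: indepS (is_basis_indep bB).
  by rewrite finset.subUset finset.sub1set xB finset.subsetIl.
have [B'' bB'' []] := basis_extension Ai bB'.
rewrite finset.subUset finset.sub1set => /andP[xB'' IB''] B''s.
have {}B''s : B'' \subset (x |: B')%SET.
  apply: fintype.subset_trans B''s _.
  by rewrite -finset.setUA finset.setUS// finset.subUset finset.subsetIr/=.
have cB : #|B''| = #|B'|.
  by apply/eqP; rewrite eqn_leq (indep_leq_basis (is_basis_indep bB'') bB')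
    (indep_leq_basis (is_basis_indep bB') bB'').
(* [B''] has as many elements as [B'], so it misses exactly one element of [x |: B']. *)
have /cards1P[z zE] : #|(x |: B') :\: B''|%SET == 1%N.
  by rewrite cardsD (finset.setIidPr B''s) cardsU1 xB' cB addnK.
have : z \in ((x |: B') :\: B'')%SET by rewrite zE finset.set11.
rewrite !inE => /andP[zB'' /predU1P[zx|zB']]; first by rewrite zx xB'' in zB''.
exists z; first rewrite inE zB' andbT.
  by apply: contra zB'' => zB; apply: (fintype.subsetP IB''); rewrite inE zB.
have eB'' : B'' = ((x |: B') :\ z)%SET.
  by rewrite -zE finset.setDDr finset.setDv finset.set0U (finset.setIidPr B''s).
apply/negP => lt; have := oB' _ bB''; apply/negP; rewrite lt_geF//.
rewrite -(ltrD2l (w z)) eB''.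
rewrite -(big_setD1 z); last by rewrite !inE zB' orbT.
by rewrite big_setU1//= ltrD2r.
Qed.

(* Only the order of the weights matters: the lightest element on which two
   optimal bases differ could be exchanged into the one missing it. *)
Lemma optimal_basis_unique {R : realDomainType} N (w w' : T -> R) B B' :
    {in ground N &, injective w} ->
    {in ground N &, forall x y, w x < w y -> w' x < w' y} ->
  optimal_basis N w B -> optimal_basis N w' B' -> B = B'.
Proof.
move=> winj ww' oB oB'; have [bB _] := oB; have [bB' _] := oB'.
apply/eqP; apply: contrapT => /negP neq.
pose D := ((B :\: B') :|: (B' :\: B))%SET.
have [x0 x0D] : exists x0, x0 \in D.
  apply/set0Pn; apply: contra neq; rewrite finset.setU_eq0 !finset.setD_eq0.
  by rewrite finset.eqEsubset.
have [x xD xmin] := Order.TotalTheory.arg_minP w x0D.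
have inG z : z \in D -> z \in ground N.
  by move=> /finset.setUP[]/finset.setDP[zB _];
    apply: (fintype.subsetP _ _ zB); exact: is_basis_ground.
have lt z : z \in D -> z != x -> w x < w z.
  move=> zD zx; rewrite lt_neqAle xmin// andbT; apply: contra zx => /eqP e.
  by apply/eqP/winj; rewrite ?inG.
have {}xD : x \in D by exact: xD.
case/finset.setUP: (xD) => /finset.setDP[yx nx].
  have [z zBB /negP] := optimal_basis_exchange bB oB' yx nx; apply.
  have zD : z \in D by rewrite finset.in_setU zBB orbT.
  apply: ww'; [exact: inG|exact: inG|apply: lt => //].
  by apply: contraTneq zBB => ->; rewrite inE yx.
have [z zBB /negP] := optimal_basis_exchange bB' oB yx nx; apply.
apply: lt; first by rewrite finset.in_setU zBB.
by apply: contraTneq zBB => ->; rewrite inE yx.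
Qed.

End MinimumBases.

(** * Interdiction values and their maximum *)

Section InterdictionValues.
Set Implicit Arguments.
Unset Strict Implicit.
Context {R : realType} {p : nat} {T : finType}.
Variables (M : matroid T) (a : T -> rat) (b : 'I_p -> T -> rat).
Implicit Types (l : 'rV[R]_p) (N : matroid T).

Lemma is_affine_set_weight (B : {set T}) :
  is_affine (fun l : 'rV[R]_p => set_weight a b B l).
Proof.
exists (\sum_(e in B) ratr (a e)), (\row_i \sum_(e in B) ratr (b i e)) => l.
rewrite /set_weight /affine /weight big_split /= exchange_big /=.
by congr (_ + _); apply: eq_bigr => i _; rewrite mxE mulr_suml;
  apply: eq_bigr => e _; rewrite mulrC.
Qed.

Lemma is_affine_weight e : is_affine (fun l : 'rV[R]_p => weight a b e l).
Proof.
have [c [u H]] := is_affine_set_weight [set e]%SET.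
by exists c, u => l; rewrite -H /set_weight big_set1.
Qed.

Lemma min_basisP N l :
  optimal_basis N (fun x => weight a b x l) (min_basis a b N l).
Proof.
rewrite /min_basis; case: pickP => [B /andP[bB /forall_inP H]|none] /=.
  by split.
have [B0 bB0 _] := maxset_exists (indep0 N).
case: (Order.TotalTheory.arg_minP (fun B => set_weight a b B l) bB0).
move=> B bB Bmin.
have := none B; rewrite [is_basis _ _]bB /= => /negP; case.
by apply/forall_inP => B' bB'; exact: Bmin.
Qed.

Lemma interdict_value_le e l B : is_basis (delete M e) B ->
  interdict_value M a b e l <= set_weight a b B l.
Proof. by move=> bB; have [_] := min_basisP (delete M e) l; apply. Qed.

(** [B] attains the minimum at [l], and the strict order at [l'] survives at [l], so uniqueness
    identifies [B] with the optimum at [l']. *)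
Lemma interdict_valueE e l l' B :
    {in ground M &, injective (fun x => weight a b x l')} ->
    {in ground M &, forall x y, weight a b x l' < weight a b y l' ->
                                weight a b x l < weight a b y l} ->
    interdict_value M a b e l = set_weight a b B l -> is_basis (delete M e) B ->
  B = min_basis a b (delete M e) l'.
Proof.
move=> inj mono yB bB; apply/esym.
apply: (optimal_basis_unique (N := delete M e)) (min_basisP _ _) _.
- by move=> x y /finset.setD1P[_ xM] /finset.setD1P[_ yM]; exact: inj.
- by move=> x y /finset.setD1P[_ xM] /finset.setD1P[_ yM]; exact: mono.
- split=> // B' /(interdict_value_le l).
  by rewrite yB.
Qed.

Lemma opt_value_le e l : e \in ground M ->
  interdict_value M a b e l <= opt_value M a b l.
Proof.
move=> eM; apply: ub_le_sup; last by exists e.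
have [f _ fmax] :=
  Order.TotalTheory.arg_maxP (fun f => interdict_value M a b f l) eM.
by exists (interdict_value M a b f l) => _ [g /= gM <-]; exact: fmax.
Qed.

Lemma opt_valueP e0 l : e0 \in ground M ->
  exists2 e, e \in ground M & opt_value M a b l = interdict_value M a b e l.
Proof.
move=> e0M.
have [f fM fmax] :=
  Order.TotalTheory.arg_maxP (fun f => interdict_value M a b f l) e0M.
exists f => //; apply/le_anti; rewrite opt_value_le// andbT.
apply: ge_sup; first by exists (interdict_value M a b f l), f.
by move=> _ [g /= gM <-]; exact: fmax.
Qed.

End InterdictionValues.

(** * Regions attained by one fixed set of pieces *)

Section Regions.
Set Implicit Arguments.
Unset Strict Implicit.
Context {R : realType} {p : nat} {T : finType}.
Variables (M : matroid T) (a : T -> rat) (b : 'I_p -> T -> rat).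
Variable J : 'I_p -> interval R.
Implicit Types (l : 'rV[R]_p) (e f : T) (D U O : set 'rV[R]_p).

Local Notation I := (box J).
Local Notation w := (weight a b).
Local Notation W := (set_weight a b).
Local Notation y := (interdict_value M a b).
Local Notation ymax := (opt_value M a b).
Local Notation pieces := (interdict_pieces M a b J).

Lemma box_convex l l' (t : R) : I l -> I l' -> 0 <= t <= 1 ->
  I (l + t *: (l' - l)).
Proof.
move=> Il Il' /andP[t0 t1] i; rewrite !mxE.
have := Il i; have := Il' i; move: (l 0 i) (l' 0 i) => x x' x'J xJ.
have conv z z' (s : R) : 0 <= s -> s <= 1 ->
    z \in J i -> z' \in J i -> z <= z' -> z + s * (z' - z) \in J i.
  move=> s0 s1 zJ z'J zz'; apply: (@interval_is_interval _ (J i) z z') => //.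
  rewrite lerDl mulr_ge0 ?subr_ge0//= -lerBrDl ler_piMl ?subr_ge0//.
have [xx'|/ltW x'x] := leP x x'; first exact: conv.
rewrite (_ : _ + _ = x' + (1 - t) * (x - x')); last by ring.
by apply: conv; rewrite ?subr_ge0// gerBl.
Qed.

(** Ties are tested between sets, not only between elements, since the values [y f] are weights of
    bases. *)
Definition generic l : Prop := forall B B' : {set T},
  W B l = W B' l -> forall l' : 'rV[R]_p, W B l' = W B' l'.

Lemma generic_exists O : open O -> O !=set0 -> exists2 l, O l & generic l.
Proof.
move=> oO O0.
have [|l Ol gl] := @generic_point _ _ ({set T} * {set T})%type
  (fun k l => W k.1 l - W k.2 l) O _ oO O0.
  by move=> k; apply: is_affineB; exact: is_affine_set_weight.
exists l => // B B' e l'; apply/eqP; rewrite -subr_eq0; apply/eqP.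
by apply: (gl (B, B')); rewrite /= e subrr.
Qed.

(** A tie of two elements at a generic point would make their separating set the whole space, which
    contains a vertical line as soon as [p > 0]. *)
Lemma generic_injective l : (0 < p)%N -> separating_nonvertical R M a b ->
  generic l -> {in ground M &, injective (fun x => w x l)}.
Proof.
move=> p0 nv gl x x' xM x'M e; apply/eqP/negP => /negP xx'.
apply: (nv x x') => //.
have lastP : (p.-1 < p)%N by rewrite prednK.
exists (Ordinal lastP); split; first by rewrite /= prednK.
exists 0 => t; rewrite /separating /=.
have := gl [set x]%SET [set x']%SET; rewrite /set_weight !big_set1.
by move=> /(_ e)/(_ (0 + t *: delta_mx 0 (Ordinal lastP))); rewrite !big_set1.
Qed.

(** A common point forces the two fixed sets of attaining pieces to coincide. *)
Lemma attained_regionU F (g : 'rV[R]_p -> R) U U' :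
    attained_region I F g U -> attained_region I F g U' -> U `&` U' !=set0 ->
  attained_region I F g (U `|` U').
Proof.
move=> [[V oV ->] [l1 l1U] cU [S S0 HS]] [[V' oV' ->] _ cU' [S' _ HS']].
move=> meet; split.
- by exists (V `|` V'); [exact: openU|rewrite setIUr].
- by exists l1; move: l1U; apply: interiorS; exact: subsetUl.
- exact: connectedU.
- exists S => // l [/HS//|/HS' ->].
  by have [l2 [/HS <- /HS' <-]] := meet.
Qed.

(** Both maximal regions absorb [V], hence meet, hence absorb each other. *)
Lemma maximal_attained_region_eq F (g : 'rV[R]_p -> R) U U' V :
    is_maximal (attained_region I F g) U ->
    is_maximal (attained_region I F g) U' ->
    attained_region I F g V -> U `&` V !=set0 -> U' `&` V !=set0 -> U = U'.
Proof.
move=> [Ua Um] [U'a U'm] Va UV U'V.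
have eU := Um _ (attained_regionU Ua Va UV) (@subsetUl _ _ _).
have eU' := U'm _ (attained_regionU U'a Va U'V) (@subsetUl _ _ _).
have UU' : U `&` U' !=set0.
  by have [l [Ul Vl]] := UV; exists l; split=> //; rewrite -eU'; right.
rewrite -(Um _ (attained_regionU Ua U'a UU') (@subsetUl _ _ _)).
exact: U'm (attained_regionU Ua U'a UU') (@subsetUr _ _ _).
Qed.

(** Take [B] optimal at an interior point [l1] of [D]: [W B] minus the affine formula is nonnegative
    on [D] and zero at [l1], hence zero everywhere. *)
Lemma linear_polyhedron_basis f D c (u : 'rV[R]_p) : full_dim D ->
    (forall l, D l -> y f l = affine c u l) ->
  exists2 B, is_basis (delete M f) B & forall l, W B l = affine c u l.
Proof.
move=> [l1 l1D] Dcu; exists (min_basis a b (delete M f) l1).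
  by have [] := min_basisP a b (delete M f) l1.
set B := min_basis _ _ _ _ => l; apply/eqP; rewrite -subr_eq0; apply/eqP.
apply: (is_affine_ge0_eq0 (F := fun l => W B l - affine c u l)
  (O := interior D) (l0 := l1)) => //.
- by apply: is_affineB; [exact: is_affine_set_weight|exists c, u].
- exact: open_interior.
- move=> l2 /interior_subset Dl2; rewrite subr_ge0 -Dcu//.
  by apply: interdict_value_le; have [] := min_basisP a b (delete M f) l1.
- by rewrite -Dcu ?subrr//; exact: interior_subset.
Qed.

Lemma graph_over_sub (g : 'rV[R]_p -> R) D D' :
  graph_over g D `<=` graph_over g D' -> D `<=` D'.
Proof.
by move=> DD' l Dl; have [|l' D'l' [<-]] := DD' (l, g l); first exists l.
Qed.

(** Optimality of [B] amounts to finitely many affine inequalities [W B l - W B' l <= 0], one for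
    each basis [B']. *)
Lemma optimality_polyhedral f B : is_basis (delete M f) B ->
  polyhedral I (I `&` [set l | y f l = W B l]).
Proof.
move=> bB.
have /choice[h hE] (B' : {set T}) : exists h : R * 'rV[R]_p,
    forall l, W B l - W B' l = affine h.1 h.2 l.
  have [c [u H]] := is_affineB (@is_affine_set_weight R p T a b B)
                               (@is_affine_set_weight R p T a b B').
  by exists (c, u).
exists [seq h B' | B' <- enum {set T} & is_basis (delete M f) B'].
congr (_ `&` _); apply/seteqP; split => l /= H.
  move=> _ /mapP[B' + ->]; rewrite mem_filter => /andP[bB' _].
  by rewrite -hE subr_le0 -H; exact: interdict_value_le.
apply/le_anti/andP; split; first exact: interdict_value_le.
rewrite -subr_le0 hE; apply/H/map_f; rewrite mem_filter mem_enum andbT.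
by have [] := min_basisP a b (delete M f) l.
Qed.

Section Region.
Variables (l0 : 'rV[R]_p) (e : T).

Local Notation mb f := (min_basis a b (delete M f) l0).

Definition order_region : set 'rV[R]_p :=
  [set l | {in ground M &, forall x x', w x l0 < w x' l0 -> w x l < w x' l}].

(** The bases are frozen at [l0], which makes every condition a strict affine inequality in [l]. *)
Definition value_region : set 'rV[R]_p :=
  [set l | forall f, (f \in ground M) && (W (mb f) l0 < W (mb e) l0) ->
                     W (mb f) l < W (mb e) l].

Definition region : set 'rV[R]_p := I `&` (order_region `&` value_region).

(** Under the hypotheses that follow, this is the domain of the only piece of [y f] that has a point
    over [region]. *)
Definition optimality_domain f := I `&` [set l | y f l = W (mb f) l].

Hypotheses (inj : {in ground M &, injective (fun x => w x l0)}).

Lemma order_regionE l f B : order_region l -> is_basis (delete M f) B ->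
  y f l = W B l -> B = mb f.
Proof. by move=> Rl bB yB; apply: interdict_valueE yB bB. Qed.

Lemma interdict_value_region l f : order_region l -> y f l = W (mb f) l.
Proof.
move=> Rl; rewrite -(order_regionE (B := min_basis a b (delete M f) l) Rl)//.
by have [] := min_basisP a b (delete M f) l.
Qed.

Hypotheses (gl0 : generic l0) (l0I : interior I l0).
Hypotheses (eM : e \in ground M) (ye : ymax l0 = y e l0).

Lemma order_region0 : order_region l0. Proof. by []. Qed.

Lemma region_open : exists2 O, open O & region = I `&` O.
Proof.
exists (order_region `&` value_region) => //; apply: openI.
  have := @open_affine_lt_family _ _ (T * T)%type
   (fun k => [&& k.1 \in ground M, k.2 \in ground M & w k.1 l0 < w k.2 l0])
   (fun k l => w k.1 l) (fun k l => w k.2 l)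
   (fun k => is_affine_weight _ _ _) (fun k => is_affine_weight _ _ _).
  congr open; apply/seteqP; split => l H.
    by move=> x x' xM x'M lt; apply: (H (x, x')); rewrite /= xM x'M.
  by move=> [x x'] /and3P[]; exact: H.
by apply: open_affine_lt_family => f; exact: is_affine_set_weight.
Qed.

Lemma region0 : region l0.
Proof. by split; [exact: interior_subset|split=> // f /andP[]]. Qed.

Lemma region_interior : interior region l0.
Proof.
have [V oV RE] := region_open; rewrite RE interiorI; split=> //.
by rewrite (interior_id V).1//; have := region0; rewrite RE => -[].
Qed.

Lemma region_connected : connected region.
Proof.
apply: convex_connected => l l' t [Il [ol vl]] [Il' [ol' vl']] t01.
split; first exact: box_convex.
split => [x x' xM x'M lt|f fM].
  by apply: affine_lt_convex; rewrite ?ol ?ol'//; exact: is_affine_weight.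
by apply: affine_lt_convex; rewrite ?vl ?vl'//; exact: is_affine_set_weight.
Qed.

(** A tie at [l0] persists everywhere because [l0] is generic. *)
Lemma region_dichotomy f : f \in ground M ->
  W (mb f) l0 < W (mb e) l0 \/ forall l, W (mb f) l = W (mb e) l.
Proof.
move=> fM; have := opt_value_le a b l0 fM; rewrite ye.
rewrite (interdict_value_region f order_region0)
        (interdict_value_region e order_region0).
by rewrite le_eqVlt => /predU1P[/gl0|]; [right|left].
Qed.

Lemma region_opt_value l : region l -> ymax l = W (mb e) l.
Proof.
move=> [_ [ol vl]]; apply/le_anti.
rewrite -[X in _ && (X <= _)](interdict_value_region e ol).
rewrite opt_value_le// andbT; have [f fM ->] := opt_valueP a b l eM.
rewrite (interdict_value_region f ol).
have [lt|->//] := region_dichotomy fM.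
by apply/ltW/vl; rewrite fM.
Qed.

Lemma region_opt_valueE l f : region l -> f \in ground M -> y f l = ymax l ->
  forall l', W (mb f) l' = W (mb e) l'.
Proof.
move=> Rl fM; rewrite (region_opt_value Rl); have [_ [ol vl]] := Rl.
rewrite (interdict_value_region f ol) => eq.
have [lt|//] := region_dichotomy fM.
by have := vl f; rewrite fM lt eq ltxx => /(_ isT).
Qed.

(** The affine formula on [D] is the weight of a single basis, and at the point [l] of the region
    that basis can only be [mb f]. *)
Lemma sub_optimality_domain f D c (u : 'rV[R]_p) l : region l -> D `<=` I ->
    full_dim D -> (forall l, D l -> y f l = affine c u l) -> D l ->
  D `<=` optimality_domain f.
Proof.
move=> [_ [ol _]] DI fD Dcu Dl.
have [B bB BE] := linear_polyhedron_basis fD Dcu.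
have e' : B = mb f by apply: (order_regionE ol bB); rewrite Dcu// BE.
by move=> l' Dl'; split; [exact: DI|rewrite /= -e' BE Dcu].
Qed.

Lemma region_sub_optimality_domain f : region `<=` optimality_domain f.
Proof. by move=> l [Il [ol _]]; split=> //=; exact: interdict_value_region. Qed.

Lemma optimality_domain_linear f :
  linear_polyhedron I (y f) (graph_over (y f) (optimality_domain f)).
Proof.
exists (optimality_domain f); split=> //.
- by apply: optimality_polyhedral; have [] := min_basisP a b (delete M f) l0.
- exists l0; have := region_interior.
  by apply: interiorS; exact: region_sub_optimality_domain.
- have [c [u H]] := @is_affine_set_weight R p T a b (mb f).
  by exists c, u => l [_ /= ->].
Qed.

Lemma region_linear_piece f P l v : region l -> linear_piece I (y f) P ->
  P (l, v) -> P = graph_over (y f) (optimality_domain f).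
Proof.
move=> Rl [[D [Dp fD [c [u Dcu]] ->]] Pmax] [l' Dl' [e1 _]].
rewrite {}e1 in Dl'; apply/esym/Pmax; first exact: optimality_domain_linear.
have DI : D `<=` I by have [s ->] := Dp; exact: subIsetl.
by apply/image_subset/(sub_optimality_domain Rl DI fD Dcu).
Qed.

(** Any larger linear polyhedron has a domain through [l0], so that domain falls back inside
    [optimality_domain f]. *)
Lemma optimality_domain_piece f :
  linear_piece I (y f) (graph_over (y f) (optimality_domain f)).
Proof.
split=> [|_ [D [Dp fD [c [u Dcu]] ->]] /graph_over_sub sD].
  exact: optimality_domain_linear.
congr graph_over; apply/seteqP; split=> //.
have DI : D `<=` I by have [s ->] := Dp; exact: subIsetl.
apply: (sub_optimality_domain region0 DI fD Dcu).
exact/sD/region_sub_optimality_domain/region0.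
Qed.

(** Over [region] the attaining pieces come exactly from the [f] whose basis weight coincides with
    that of [e] everywhere, a condition independent of the point. *)
Lemma attained_region_region : attained_region I pieces ymax region.
Proof.
split; [exact: region_open|by exists l0; exact: region_interior
       |exact: region_connected|].
exists [set P | exists2 f,
    f \in ground M /\ (forall l, W (mb f) l = W (mb e) l) &
    P = graph_over (y f) (optimality_domain f)].
  by exists (graph_over (y e) (optimality_domain e)), e.
move=> l Rl; apply/seteqP; split => P.
  move=> [[f fM Pf] Pl]; have PE := region_linear_piece Rl Pf Pl.
  exists f => //; split=> //; move: Pl; rewrite PE => -[l' _ [-> yl]].
  exact: region_opt_valueE Rl fM yl.
move=> [f [fM fe] ->]; split.
  by exists f => //; exact: optimality_domain_piece.
exists l; first exact: region_sub_optimality_domain.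
have [_ [ol _]] := Rl.
by rewrite (interdict_value_region f ol) fe (region_opt_value Rl).
Qed.

End Region.

End Regions.

(** * Counting patches by order type and maximizing element *)

Section Counting.
Set Implicit Arguments.
Unset Strict Implicit.

(** A patch can have many witnesses, hence a relation: choosing one key per element of [A] gives an
    injection into [K]. *)
Lemma card_le_relation {Z : Type} (A : set Z) (Y : finType) (K : {set Y})
    (r : Z -> Y -> Prop) :
    (forall z, A z -> exists2 k, k \in K & r z k) ->
    (forall z z' k, A z -> A z' -> r z k -> r z' k -> z = z') ->
  exists2 n : nat, (A #= `I_n)%card & (n <= #|K|)%N.
Proof.
move=> rex rinj.
(* [Y] may be empty, so elements outside [A] get [None]. *)
have /choice[g gP] (z : Z) : exists o : option Y,
    A z -> exists k, [/\ o = Some k, k \in K & r z k].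
  have [/rex[k kK rk]|nA] := pselect (A z).
    by exists (Some k) => _; exists k.
  by exists None.
pose h z := if g z is Some k then index k (enum K) else 0%N.
have hinj : {in A &, injective h}.
  move=> z z'; rewrite !in_setE => Az Az'; have [k [e kK rk]] := gP _ Az.
  have [k' [e' k'K rk']] := gP _ Az'; rewrite /h e e' => eqi.
  have kk' : k = k' by apply: (index_inj k _ _ eqi); rewrite mem_enum.
  by rewrite -kk' in rk'; exact: rinj rk rk'.
have hK : h @` A `<=` `I_#|K|.
  move=> _ [z /gP[k [e kK _]] <-].
  by rewrite /= /h e cardE index_mem mem_enum.
have [n hn] := sub_finite_set hK (finite_II _).
exists n; first by rewrite -(card_eql (inj_card_eq hinj)).
by rewrite -card_le_II -(card_le_eql hn); exact: subset_card_le.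
Qed.

Context {R : realType} {p : nat} {T : finType}.
Variables (M : matroid T) (a : T -> rat) (b : 'I_p -> T -> rat).
Variable J : 'I_p -> interval R.

Local Notation X := {x : T | x \in ground M}.

Definition order_type (l : 'rV[R]_p) : {set X * X} :=
  [set k | weight a b (val k.1) l < weight a b (val k.2) l]%SET.

Definition order_types : {set {set X * X}} :=
  [set B | `[< exists l, B = order_type l >]]%SET.

Lemma card_order_types :
  (#|order_types| <= (#|ground M| * #|ground M|).+1 ^ p)%N.
Proof.
have /choice[h hE] (k : X * X) : exists h : R * 'rV[R]_p,
    forall l,
      weight a b (val k.2) l - weight a b (val k.1) l = affine h.1 h.2 l.
  have [c [u H]] := is_affineB (@is_affine_weight R p T a b (val k.2))
                               (@is_affine_weight R p T a b (val k.1)).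
  by exists (c, u).
have <- : #|{: X * X}| = (#|ground M| * #|ground M|)%N.
  by rewrite card_prod card_sig.
apply: (card_positivity_sets (c := fun k => (h k).1) (u := fun k => (h k).2)).
move=> B; rewrite inE => /asboolP[l ->]; exists l => k.
by rewrite inE -hE subr_gt0.
Qed.

Definition patch_witness P (U : set 'rV[R]_p) (l : 'rV[R]_p) (e : T) : Prop :=
  [/\ is_maximal (attained_region (box J) (interdict_pieces M a b J)
                                  (opt_value M a b)) U,
      P = graph_over (opt_value M a b) U, U l, interior (box J) l &
      [/\ generic a b l, e \in ground M &
          opt_value M a b l = interdict_value M a b e l]].

Lemma surface_patch_point P : surface_patches M a b J P ->
  exists U l e, patch_witness P U l e.
Proof.
move=> [U Umax <-]; have [[[V oV UV] Ufd _ [S [Q SQ] HS]] _] := Umax.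
have [l Ul gl] := generic_exists a b (@open_interior _ U) Ufd.
(* [S] is nonempty, so some piece attains the envelope at [l]; the element it comes from shows that
   the ground set is nonempty. *)
have [[e0 e0M _] _] :
    attaining (interdict_pieces M a b J) (opt_value M a b) l Q.
  by rewrite HS//; exact: interior_subset.
have [e eM el] := opt_valueP a b l e0M.
exists U, l, e; split => //; first exact: interior_subset.
by move: Ul; apply: interiorS; rewrite UV; exact: subIsetl.
Qed.

(** The parameter space is a single point, so the domains of any two patches meet. The boolean bound
    is 0 for an empty ground set, where the final estimate is 0 as well. *)
Lemma card_surface_patches0 : p = 0%N ->
  exists2 n : nat, (surface_patches M a b J #= `I_n)%card &
    (n <= (0 < #|ground M|))%N.
Proof.
move=> p0; have pt (l l' : 'rV[R]_p) : l = l'.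
  by apply/rowP => -[i ip]; exfalso; rewrite p0 in ip.
pose K := [set _ : unit | 0 < #|ground M|]%N%SET.
have [|P P' _|n Pn nK] := card_le_relation (A := surface_patches M a b J)
   (K := K) (r := fun _ _ => True).
- move=> P /surface_patch_point[U [l [e [_ _ _ _ [_ eM _]]]]].
  by exists tt => //; rewrite inE; apply/card_gt0P; exists e.
- move=> /surface_patch_point[U [l [_ [Um -> Ul _ _]]]].
  move=> /surface_patch_point[U' [l' [_ [Um' -> Ul' _ _]]]] _ _.
  congr graph_over; apply: (maximal_attained_region_eq Um Um' (proj1 Um)).
    by exists l.
  by exists l'; split=> //; rewrite (pt l' l).
exists n => //; apply: leq_trans nK _.
have [m0|m0] := ltnP 0 #|ground M|.
  by rewrite (leq_trans (max_card _))// card_unit.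
by rewrite leqn0 cards_eq0; apply/eqP/setP => -[]; rewrite !inE ltnNge m0.
Qed.

(** The domains of two patches with the same key both meet the region around the generic point of
    the first, so they coincide. *)
Lemma card_surface_patches : (0 < p)%N -> separating_nonvertical R M a b ->
  exists2 n : nat, (surface_patches M a b J #= `I_n)%card &
    (n <= (#|ground M| * #|ground M|).+1 ^ p * #|ground M|)%N.
Proof.
move=> p0 nv.
pose r P (k : {set X * X} * T) := exists U l,
  patch_witness P U l k.2 /\ k.1 = order_type l.
have [P|P P' [k e] _ _|n Pn nK] :=
  card_le_relation (A := surface_patches M a b J)
                   (K := finset.setX order_types (ground M)) (r := r).
- move=> /surface_patch_point[U [l [e Ple]]]; have [_ _ _ _ [_ eM _]] := Ple.
- exists (order_type l, e); last by exists U, l.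
  by rewrite inE /= eM andbT inE; apply/asboolP; exists l.
- move=> [U [l [[Um -> Ul lJ [/= gl eM el]] /= kl]]].
  move=> [U' [l' [[Um' -> Ul' l'J [/= gl' _ el']] /= kl']]].
  congr graph_over.
  have inj := generic_injective p0 nv gl.
  apply: (maximal_attained_region_eq Um Um'
            (attained_region_region inj gl lJ eM el)).
    by exists l; split=> //; exact: region0.
  have ol' : order_region M a b l l'.
    move=> x x' xM x'M lt.
    have : (exist _ x xM, exist _ x' x'M) \in order_type l by rewrite inE.
    by rewrite -kl kl' inE.
  exists l'; split=> //; split; first exact: interior_subset.
  (* If the values for [f] and [e] tied at [l'], genericity of [l'] would make them tie at [l] too,
     against [lt]. *)
  split=> // f /andP[fM lt].
  have := opt_value_le a b l' fM; rewrite el'.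
  rewrite (interdict_value_region inj f ol') (interdict_value_region inj e ol').
  rewrite le_eqVlt => /predU1P[/gl'/(_ l) eq|//].
  by rewrite eq ltxx in lt.
exists n => //; apply: leq_trans nK _.
by rewrite cardsX leq_mul2r card_order_types orbT.
Qed.

End Counting.

Theorem theorem5p5 (R : realType) (p : nat) (eps : R) (eps_gt0 : 0 < eps) :
  exists2 C : R, 0 < C &
    forall (T : finType) (M : matroid T) (a : T -> rat) (b : 'I_p -> T -> rat)
           (J : 'I_p -> interval R),
      separating_distinct R M a b ->
      separating_nonvertical R M a b ->
      full_rank_deletions M ->
      exists2 n : nat, (surface_patches M a b J #= `I_n)%card &
        n%:R <= C * (#|ground M|%:R `^ ((2 * p + 1)%:R * (p%:R + eps))).
Proof.
(* The constant comes from [m ^ 2 + 1 <= 2 * m ^ 2] for [m > 0], raised to the power [p]. *)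
exists (2 ^+ p) => [|T M a b J _ nv _]; first exact: exprn_gt0.
have [p0|p0] := posnP p.
  have [n Pn le] := card_surface_patches0 M a b J p0; exists n => //.
  apply: (@le_trans _ _ (0 < #|ground M|)%N%:R); first by rewrite ler_nat.
  have [m0|_] := ltnP 0 #|ground M|;
    last by rewrite mulr_ge0 ?exprn_ge0// powR_ge0.
  rewrite mulr_ege1 ?exprn_ege1 ?ler1n//.
  rewrite -[leLHS](powRr0 (#|ground M|%:R : R)) ler_powR ?ler1n//.
  by rewrite mulr_ge0// addr_ge0// ltW.
have [n Pn le] := card_surface_patches J p0 nv; exists n => //.
set m := #|ground M| in le *.
have [m0|m0] := posnP m.
  by move: le; rewrite m0 muln0 leqn0 => /eqP ->;
    rewrite mulr_ge0 ?exprn_ge0// powR_ge0.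
have {}le : (n <= 2 ^ p * m ^ (2 * p + 1))%N.
  apply: leq_trans le _.
  rewrite expnD expn1 mulnA leq_mul2r expnM -expnMn leq_exp2r//.
  by rewrite -mulnn mul2n -addnn -addn1 leq_add2l muln_gt0 m0 orbT.
apply: (@le_trans _ _ ((2 ^ p * m ^ (2 * p + 1))%N%:R)).
  by rewrite ler_nat.
(* Since [p >= 1], the factor [p + eps] is at least 1 and only enlarges the exponent [2 * p + 1]. *)
rewrite natrM !natrX ler_pM2l ?exprn_gt0// -powR_mulrn ?ler0n//.
by rewrite ler_powR ?ler1n// ler_peMr// -[leLHS]addr0 lerD ?ler1n// ltW.
Qed.
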